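(* Let $\mathcal{H}=\{rrb\}$. Then, for every positive integer $n$, $h_2(n,\mathcal{H})=\lceil\sqrt{n}\,\rceil$.
   Context: Edge-colorings of the complete graph $K_n$ use colors from $\{r,b,y\}$ (red, blue, yellow); they need not be proper, and not all colors need be used. A pattern is an edge-colored triangle, denoted by the multiset of the colors of its three edges; e.g. $rrb$ is the triangle with two red edges and one blue edge. For a family $\mathcal{H}$ of patterns, $\operatorname{Forb}(n,\mathcal{H})$ is the set of all edge-colorings of $K_n$ with colors from $\{r,b,y\}$ in which no triangle has a coloring belonging to $\mathcal{H}$. For an edge-coloring $c$ of $K_n$, $h_2(c)$ is the maximum $k$ such that there is a set of $k$ vertices whose induced edges use at most two of the three colors. Finally, $h_2(n,\mathcal{H})=\min\{h_2(c): c\in\operatorname{Forb}(n,\mathcal{H})\}$. *)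

(* Defs.v *)
From HB Require Import structures.
From mathcomp Require Import all_boot all_order all_algebra.
From mathcomp Require Import finmap multiset reals.

Set Implicit Arguments.
Unset Strict Implicit.
Unset Printing Implicit Defensive.

Local Open Scope mset_scope.

Variant color := Red | Blue | Yellow.

Definition ord_of_color (a : color) : 'I_3 :=
  match a with
  | Red => @Ordinal 3 0 isT
  | Blue => @Ordinal 3 1 isT
  | Yellow => @Ordinal 3 2 isT
  end.

Definition color_of_ord (i : 'I_3) : color :=
  match val i with 0 => Red | 1 => Blue | _ => Yellow end.

Lemma ord_of_colorK : cancel ord_of_color color_of_ord.
Proof. by case. Qed.

HB.instance Definition _ := Finite.copy color (can_type ord_of_colorK).

Notation edge n := {e : {set 'I_n} | #|e| == 2}.
Notation coloring n := {ffun edge n -> color}.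

Section Colorings.

Variable n : nat.

Definition induced_edges (S : {set 'I_n}) : {set edge n} :=
  [set e : edge n | val e \subset S].

Definition pattern (c : coloring n) (T : {set 'I_n}) : {mset color} :=
  seq_mset [seq c e | e in induced_edges T].

Definition Forb (H : {fset {mset color}}) : {set coloring n} :=
  [set c : coloring n |
    [forall T : {set 'I_n}, (#|T| == 3) ==> (pattern c T \notin H)]].

Definition colors_used (c : coloring n) (S : {set 'I_n}) : {set color} :=
  [set c e | e in induced_edges S].

Definition h2_coloring (c : coloring n) : nat :=
  \max_(S : {set 'I_n} | #|colors_used c S| <= 2) #|S|.

(* Since h2_coloring c <= n for every c, the neutral element n does not affect
   the minimum when Forb H is nonempty (see h2P); if Forb H is empty, the value
   is n. *)
Definition h2 (H : {fset {mset color}}) : nat :=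
  \big[minn/n]_(c in Forb H) h2_coloring c.

Lemma h2_coloring_le (c : coloring n) : h2_coloring c <= n.
Proof. by apply/bigmax_leqP => S _; rewrite -[leqRHS]card_ord max_card. Qed.

Lemma h2P H : Forb H != set0 ->
  (exists2 c, c \in Forb H & h2_coloring c = h2 H) /\
  (forall c, c \in Forb H -> h2 H <= h2_coloring c).
Proof.
move=> /set0Pn[c0 c0H].
have lb c : c \in Forb H -> h2 H <= h2_coloring c.
  move=> cH; rewrite /h2; have := mem_index_enum c.
  elim: (index_enum _) => // d s IHs; rewrite inE big_cons => /orP[/eqP<-|cs].
    by rewrite cH geq_minl.
  by case: ifP => _; [apply: leq_trans (geq_minr _ _) _|]; exact: IHs.
split=> //; case: (arg_minnP h2_coloring c0H) => c cH cmin.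
exists c => //; apply/eqP; rewrite eqn_leq lb // andbT /h2.
elim/big_ind: _ => [|x y cx cy|d]; first exact: h2_coloring_le.
- by rewrite leq_min cx.
- exact: cmin.
Qed.

End Colorings.

Definition rrb : {mset color} := [mset Red; Red; Blue].

(* Main.v *)
Require Import Defs.
From mathcomp Require Import all_boot all_order all_algebra.
From mathcomp Require Import finmap multiset reals.

Import Order.TTheory GRing.Theory Num.Theory.

(** Lower bound: in an rrb-free colouring the closed red neighbourhood of a
    vertex contains no blue edge, so it has at most [h2] vertices. A maximal
    set [I] without red edges has at most [h2] vertices too, and the closed red
    neighbourhoods of its vertices cover everything, so [n <= h2 ^ 2].
    Upper bound: place the [n] vertices on distinct cells of a [k * k] grid and
    colour a pair red if it lies in a row, yellow if it lies in a column, and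
    blue otherwise. Red is then an equivalence relation, and a set missing one
    colour is injected into the rows or into the columns. *)

(** * Colours of vertex pairs, [rrb]-free colourings and the lower bound *)

Section EdgeColor.

Variable n : nat.
Implicit Types (c : coloring n) (x y z : 'I_n) (S T : {set 'I_n}).

(* The value on the diagonal is junk. *)
Definition edge_color c x y : color :=
  if insub [set x; y] is Some e then c e else Yellow.

Lemma edge_colorE c x y (xy : #|[set x; y]| == 2) :
  edge_color c x y = c (Sub [set x; y] xy).
Proof. by rewrite /edge_color insubT. Qed.

Lemma edge_colorC c x y : edge_color c x y = edge_color c y x.
Proof. by rewrite /edge_color setUC. Qed.

Lemma notin_colors_used c S a :
  a \notin colors_used c S <->
  {in S &, forall x y, x != y -> edge_color c x y != a}.
Proof.
split=> [aS x y xS yS xy | aS].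
  have xy2 : #|[set x; y]| == 2 by rewrite cards2 xy.
  rewrite (edge_colorE _ _ _ xy2); apply: contraNneq aS => <-.
  by apply/imset_f; rewrite inE /= subUset !sub1set xS.
apply/imsetP=> -[[e e2]]; rewrite inE /= => eS ae.
have /cards2P[x [y [xy exy]]] := e2; subst e.
move: eS; rewrite subUset !sub1set => /andP[xS yS].
by have := aS x y xS yS xy; rewrite (edge_colorE _ _ _ e2) -ae eqxx.
Qed.

Lemma card_color : #|{: color}| = 3.
Proof.
rewrite -[RHS]card_ord; apply: (@bij_eq_card _ _ ord_of_color).
exists color_of_ord; first exact: ord_of_colorK.
by case=> -[|[|[|//]]] i; apply: val_inj.
Qed.

(** There are three colours in all, so using at most two means missing one. Both bounds work with
    the missed colour. *)
Lemma two_colorsP c S :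
  reflect (exists a, a \notin colors_used c S) (#|colors_used c S| <= 2).
Proof.
apply: (iffP idP) => [le2 | [a aS]].
  have: colors_used c S != setT.
    by apply: contraTneq le2 => ->; rewrite cardsT card_color.
  by rewrite -subTset => /subsetPn[a _ aS]; exists a.
apply: leq_trans (_ : #|[set~ a]| <= 2); last by rewrite cardsC1 card_color.
by apply/subset_leq_card/subsetP=> b bS; rewrite !inE; apply: contraNneq aS => <-.
Qed.

Lemma card_le_h2_coloring c S a :
  {in S &, forall x y, x != y -> edge_color c x y != a} ->
  #|S| <= h2_coloring c.
Proof.
move=> /notin_colors_used aS; apply: (leq_bigmax_cond (F := fun S => #|S|)).
by apply/two_colorsP; exists a.
Qed.

Lemma pattern_triangle c x y z : uniq [:: x; y; z] ->
  pattern c [set x; y; z] =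
  seq_mset [:: edge_color c x y; edge_color c x z; edge_color c y z].
Proof.
rewrite /= !inE negb_or andbT => /andP[/andP[xy xz] yz].
have xy2 : #|[set x; y]| == 2 by rewrite cards2 xy.
have xz2 : #|[set x; z]| == 2 by rewrite cards2 xz.
have yz2 : #|[set y; z]| == 2 by rewrite cards2 yz.
rewrite (edge_colorE _ _ _ xy2) (edge_colorE _ _ _ xz2) (edge_colorE _ _ _ yz2).
have edge_eqE (e e' : edge n) : (e == e') = (val e == val e') by [].
(* The enumeration order of the induced edges is unknown, so the multisets are compared through a
   permutation of this explicit list. *)
pose E : seq (edge n) :=
  [:: Sub [set x; y] xy2; Sub [set x; z] xz2; Sub [set y; z] yz2].
apply/eq_seq_msetP; rewrite -[X in perm_eq _ X]/(map c E); apply: perm_map.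
apply: uniq_perm; first exact: enum_uniq.
  have set2_neq u v w : v != u -> v != w -> [set u; v] != [set u; w] :> {set 'I_n}.
    move=> vu vw; apply: contraNneq vw => /finset.setP/(_ v).
    by rewrite !inE eqxx orbT (negPf vu) => /esym.
  rewrite /= !inE !edge_eqE /= andbT negb_or -andbA; apply/and3P; split.
  - by apply: set2_neq; rewrite // eq_sym.
  - by rewrite setUC set2_neq.
  - by rewrite setUC [[set y; z]]setUC set2_neq.
case=> e e2; rewrite mem_enum !inE !edge_eqE /=.
apply/idP/idP; last first.
  case/or3P=> /eqP->; rewrite !subUset !sub1set !inE !eqxx ?orbT //.
have /cards2P[u [v [uv ->]]] := e2.
rewrite subUset !sub1set !inE => /andP[].
case/orP=> [/orP[]|] /eqP eu; case/orP=> [/orP[]|] /eqP ev; subst u v;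
  by [rewrite eqxx in uv | rewrite eqxx ?orbT | rewrite setUC eqxx ?orbT].
Qed.

(** Here [x] is the common end of the two red edges, and [y], [z] span the edge that must not be
    blue. *)
Lemma rrb_freeP c :
  c \in Forb n [fset rrb]%fset <->
  forall x y z, uniq [:: x; y; z] ->
    edge_color c x y = Red -> edge_color c x z = Red -> edge_color c y z <> Blue.
Proof.
have rrbE : rrb = seq_mset [:: Red; Red; Blue].
  by apply/msetP=> a; rewrite mset_seqE !msetE2 !msetnE /=; case: a.
split.
  rewrite inE => /forallP cH x y z xyz exy exz eyz.
  have := cH [set x; y; z]; rewrite pattern_triangle // exy exz eyz rrbE.
  rewrite in_fset1 eqxx implybF; case/eqP.
  move: xyz; rewrite /= !inE negb_or andbT => /andP[/andP[xy xz] yz].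
  by rewrite setUC cardsU1 cards2 !inE xy negb_or ![z == _]eq_sym xz yz.
move=> free; rewrite inE; apply/forallP=> T; apply/implyP=> /eqP T3.
have : 2 < #|T| by rewrite T3.
case/card_gt2P=> x [y [z [[xT yT zT] [xy yz zx]]]].
have xyz : uniq [:: x; y; z] by rewrite /= !inE negb_or xy yz eq_sym zx.
have eT : [set x; y; z] = T.
  apply/eqP; rewrite eqEcard !subUset !sub1set xT yT zT /= T3.
  by rewrite setUC cardsU1 cards2 !inE xy negb_or zx eq_sym yz.
rewrite in_fset1 -eT pattern_triangle // rrbE.
apply/negP=> /eqP/eq_seq_msetP.
(* The blue edge of a bad triangle can be any of its three edges: [h1], [h2], [h3] take [x], [y],
   [z] in turn as the common end of the red ones. *)
have h1 := free x y z xyz.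
have h2 : edge_color c x y = Red -> edge_color c y z = Red ->
          edge_color c x z <> Blue.
  rewrite [edge_color c x y]edge_colorC; apply: free.
  by rewrite /= !inE negb_or eq_sym xy yz eq_sym zx.
have h3 : edge_color c x z = Red -> edge_color c y z = Red ->
          edge_color c x y <> Blue.
  rewrite [edge_color c x z]edge_colorC [edge_color c y z]edge_colorC.
  by apply: free; rewrite /= !inE negb_or zx xy eq_sym yz.
move: h1 h2 h3.
case: (edge_color c x y); case: (edge_color c x z); case: (edge_color c y z)
  => h1 h2 h3 //= _; try exact: h1; try exact: h2; exact: h3.
Qed.

Lemma leq_sqr_h2_coloring c :
  c \in Forb n [fset rrb]%fset -> n <= h2_coloring c ^ 2.
Proof.
move=> /rrb_freeP free.
pose ball x := x |: [set y | (x != y) && (edge_color c x y == Red)].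
have ball_le x : #|ball x| <= h2_coloring c.
  apply: (card_le_h2_coloring c _ Blue) => y z; rewrite !inE.
  case/orP=> [/eqP-> | /andP[xy /eqP exy]];
  case/orP=> [/eqP-> | /andP[xz /eqP exz]] yz.
  - by rewrite eqxx in yz.
  - by rewrite exz.
  - by rewrite edge_colorC exy.
  - by apply/eqP; apply: (free x) => //; rewrite /= !inE negb_or xy xz yz.
pose red_free (I : {set 'I_n}) :=
  [forall x in I, forall y in I, (x != y) ==> (edge_color c x y != Red)].
have [I /maxsetP[I_free I_max]] : {I | maxset red_free I}.
  by apply: ex_maxset; exists set0; apply/forall_inP=> x; rewrite inE.
have red_freeP (J : {set 'I_n}) :
    reflect {in J &, forall x y, x != y -> edge_color c x y != Red}
            (red_free J).
  apply: (iffP forall_inP) => [h x y xJ yJ | h x xJ].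
    by move/forall_inP: (h x xJ) => /(_ y yJ)/implyP.
  by apply/forall_inP=> y yJ; apply/implyP; exact: h.
have I_le : #|I| <= h2_coloring c.
  by apply: (card_le_h2_coloring c _ Red); apply/red_freeP.
have cover x : x \in \bigcup_(v in I) ball v.
  apply: contraT => /bigcupP x_far.
  have xI v : v \in I -> x \notin ball v.
    by move=> vI; apply/negP=> xv; apply: x_far; exists v.
  (* A vertex outside every ball has no red edge to [I], so it can be added to [I]. By maximality it
     already lies in [I], hence in its own ball, a contradiction. *)
  suff /I_max/(_ (subsetUr _ _)) : red_free (x |: I).
    move/finset.setP/(_ x); rewrite setU11 => /esym/xI.
    by rewrite /ball setU11.
  have far v : v \in I -> edge_color c v x != Red.
    move=> /[dup] vI /xI; rewrite !inE negb_or => /andP[xv].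
    by rewrite eq_sym xv.
  apply/red_freeP=> y z; rewrite !inE.
  case/orP=> [/eqP-> | yI]; case/orP=> [/eqP-> | zI] yz.
  - by rewrite eqxx in yz.
  - by rewrite edge_colorC far.
  - exact: far.
  - by move/red_freeP: I_free; apply.
rewrite -[n in n <= _]card_ord -cardsT.
have -> : [set: 'I_n] = \bigcup_(v in I) ball v.
  by apply/finset.setP=> x; rewrite inE cover.
apply: (@leq_trans (\sum_(v in I) h2_coloring c)).
  elim/big_rec2: _ => [|v m A _ A_le]; first by rewrite cards0.
  by apply: leq_trans (leq_card_setU _ _) _; apply: leq_add.
by rewrite sum_nat_const -mulnn leq_mul2r I_le orbT.
Qed.

End EdgeColor.

(** * The grid colouring and the upper bound *)

Section Grid.

Variables (n k : nat) (f : 'I_n -> 'I_k * 'I_k).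
Hypothesis f_inj : injective f.

Let row v := (f v).1.
Let col v := (f v).2.

(** An edge is an unordered pair without named ends. Its image under a coordinate is a singleton
    exactly when both ends share that coordinate. *)
Definition grid_coloring : coloring n :=
  [ffun e : edge n => if #|[set (f v).1 | v in val e]| == 1 then Red
             else if #|[set (f v).2 | v in val e]| == 1 then Yellow else Blue].

Lemma grid_edge_color x y : x != y ->
  edge_color n grid_coloring x y =
  if row x == row y then Red else if col x == col y then Yellow else Blue.
Proof.
move=> xy; have xy2 : #|[set x; y]| == 2 by rewrite cards2 xy.
rewrite edge_colorE ffunE /= !imsetU1 !imset_set1 !cards2 -/(row _) -/(col _).
by rewrite !eqSS !eqb0 !negbK.
Qed.

Lemma row_col_inj x y : row x = row y -> col x = col y -> x = y.
Proof.
by move=> exy cxy; apply: f_inj; rewrite [f x]surjective_pairing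
  [f y]surjective_pairing -/(row x) exy -/(col x) cxy.
Qed.

(** Two red edges at [x] put all three vertices in one row, so the third edge is red. *)
Lemma grid_rrb_free : grid_coloring \in Forb n [fset rrb]%fset.
Proof.
apply/rrb_freeP => x y z; rewrite /= !inE negb_or andbT => /andP[/andP[xy xz] yz].
rewrite !grid_edge_color //.
case: (eqVneq (row x) (row y)) => [-> _ | _]; last by case: ifP.
by case: ifP => // _; case: ifP.
Qed.

Lemma card_in_inj_ord (S : {set 'I_n}) (g : 'I_n -> 'I_k) :
  {in S &, injective g} -> #|S| <= k.
Proof.
by move=> g_inj; rewrite -(card_in_imset g_inj) -[k in _ <= k]card_ord max_card.
Qed.

Lemma h2_grid : h2_coloring grid_coloring <= k.
Proof.
apply/bigmax_leqP=> S /two_colorsP[a /notin_colors_used aS].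
have {}aS x y : x \in S -> y \in S -> x != y ->
    (if row x == row y then Red else if col x == col y then Yellow else Blue) != a.
  by move=> xS yS xy; rewrite -grid_edge_color //; apply: aS.
case: a aS => aS.
- apply: (card_in_inj_ord S row) => x y xS yS exy; apply/eqP/contraT => xy.
  by have := aS x y xS yS xy; rewrite exy eqxx.
(* Without blue, [S] lies in a single row or a single column: if [x] and [y] are in different rows
   they share a column, and any [z] differs in row from one of them, so it lies in that column
   too. *)
- have aligned x y : x \in S -> y \in S -> row x != row y -> col x = col y.
    move=> xS yS rxy; have xy : x != y by apply: contraNneq rxy => ->.
    by have := aS x y xS yS xy; rewrite (negPf rxy); case: ifP => // /eqP.
  have [/forall_inP same_row | ] :=
      boolP [forall x in S, forall y in S, row x == row y].
    apply: (card_in_inj_ord S col) => x y xS yS; apply: row_col_inj.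
    by have /forall_inP/(_ y yS)/eqP := same_row x xS.
  rewrite negb_forall => /existsP[x]; rewrite negb_imply => /andP[xS].
  rewrite negb_forall => /existsP[y]; rewrite negb_imply => /andP[yS rxy].
  have same_col z : z \in S -> col z = col x.
    move=> zS; have [rzx | ] := eqVneq (row z) (row x); last exact: aligned.
    by rewrite (aligned x y) // (aligned z y) // rzx.
  apply: (card_in_inj_ord S row) => u v uS vS ruv; apply: row_col_inj => //.
  by rewrite !same_col.
(* Without yellow, two vertices in one column would also share a row, that is, occupy the same
   cell. *)
- apply: (card_in_inj_ord S col) => x y xS yS cxy; apply/eqP/contraT => xy.
  have := aS x y xS yS xy; rewrite cxy eqxx.
  by case: ifP => // /eqP rxy; rewrite (row_col_inj _ _ rxy cxy) eqxx in xy.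
Qed.

End Grid.

Lemma exists_rrb_free_h2_le n k : n <= k ^ 2 ->
  exists2 c, c \in Forb n [fset rrb]%fset & h2_coloring c <= k.
Proof.
rewrite -mulnn => nk.
have nk' : n <= #|{: 'I_k * 'I_k}| by rewrite card_prod card_ord.
have f_inj : injective (fun v : 'I_n => enum_val (widen_ord nk' v)).
  by move=> u v /enum_val_inj /(congr1 val) /= /val_inj.
exists (grid_coloring _ _ (fun v : 'I_n => enum_val (widen_ord nk' v))).
  exact: grid_rrb_free.
exact: h2_grid.
Qed.

(** Both bounds in one equivalence; holding for every [k], it determines [h2]. *)
Lemma h2_rrb_leP n k : (h2 n [fset rrb]%fset <= k) = (n <= k ^ 2).
Proof.
(* The choice [k = n] only serves to show that [Forb] is nonempty, so that the minimum is
   attained. *)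
have [|c0 c0H _] := exists_rrb_free_h2_le n n.
  by rewrite -mulnn; case: (n) => // m; rewrite leq_pmulr.
have [|[c cH ch2] h2_min] := @h2P n [fset rrb]%fset.
  by apply/set0Pn; exists c0.
apply/idP/idP => [h2k | /exists_rrb_free_h2_le[d dH dk]].
  by apply: leq_trans (leq_sqr_h2_coloring _ _ cH) _; rewrite leq_sqr ch2.
exact: leq_trans (h2_min d dH) dk.
Qed.

(** * From the criterion [n <= k ^ 2] to the ceiling of the square root *)

Local Open Scope ring_scope.
Local Open Scope fset_scope.

Lemma ceil_sqrt_le_nat (R : realType) (n k : nat) :
  (Num.ceil (Num.sqrt (n%:R : R)) <= k%:Z) = (n <= k ^ 2)%N.
Proof.
rewrite ceil_le_int -[k%:~R]ger0_norm ?ler0n //.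
by rewrite -sqrtr_sqr ler_sqrt ?sqr_ge0 // -natrX ler_nat.
Qed.

Theorem lemma1p2 (R : realType) (n : nat) (n_gt0 : (0 < n)%N) :
  (h2 n [fset rrb])%:Z = Num.ceil (Num.sqrt (n%:R : R)).
Proof.
(* Once the ceiling is known to be a natural number, both sides have the same natural upper bounds,
   and each is tested against the other. *)
have ceil_ge0 : 0 <= Num.ceil (Num.sqrt (n%:R : R)).
  by rewrite ceil_ge0 (lt_le_trans _ (sqrtr_ge0 _)) // ltrN10.
apply/eqP; rewrite eq_le; apply/andP; split.
  rewrite -[X in _ <= X]gez0_abs // lez_nat h2_rrb_leP.
  by rewrite -(ceil_sqrt_le_nat R) gez0_abs.
by rewrite ceil_sqrt_le_nat -h2_rrb_leP.
Qed.
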